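(* Let $\mathfrak{G}=\langle\mathbb{N},\leqslant\rangle$ and let $L$ be a superintuitionistic predicate logic such that $\mathbf{QLC}\subseteq L\subseteq \mathsf{QSIL}(\mathfrak{G}\odot\mathbb{N})$. Then the fragment of $L$ consisting of its formulas in the language with two individual variables, a single binary predicate letter, and infinitely many unary predicate letters is $\Sigma^0_1$-hard.
   Context: Language: $\mathcal{L}$ is the predicate language (no equality, no function symbols or constants) with countably many individual variables, countably many predicate letters of every arity (nullary ones are proposition letters), $\bot$, $\wedge,\vee,\to$, $\forall,\exists$; $\neg\varphi$ abbreviates $\varphi\to\bot$. Semantics: a Kripke frame is $\mathfrak{F}=\langle W,R\rangle$ with $W\neq\varnothing$ and $R$ a partial order on $W$ (only such intuitionistic frames are considered). An augmented frame over $\mathfrak{F}$ is $\mathfrak{F}_D=\langle W,R,D\rangle$ where $D$ assigns to each $w\in W$ a non-empty set $D_w$ with $D_u\subseteq D_w$ whenever $uRw$. $\mathfrak{F}\odot\mathcal{D}$ denotes the augmented frame over $\mathfrak{F}$ with $D_w=\mathcal{D}$ for all $w$. A model over $\mathfrak{F}_D$ has an interpretation $I$ with $I(w,P)\subseteq D_w^n$ for each $n$-ary letter $P$ and $I(w,P)\subseteq I(w',P)$ whenever $wRw'$. Truth at $w$: atoms according to $I(w,\cdot)$; $\bot$ never true; $\wedge,\vee$ pointwise; $\varphi\to\psi$ is true at $w$ iff for every $v$ with $wRv$, truth of $\varphi$ at $v$ implies truth of $\psi$ at $v$; $\forall x\,\varphi$ is true at $w$ iff for every $v$ with $wRv$ and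 every $a\in D_v$, $\varphi(a)$ is true at $v$; $\exists x\,\varphi$ is true at $w$ iff $\varphi(a)$ is true at $w$ for some $a\in D_w$. A formula is valid on $\mathfrak{F}_D$ if it is true at every world $w$ of every model over $\mathfrak{F}_D$ under every assignment of elements of $D_w$ to its free variables; it is valid on $\mathfrak{F}$ if it is valid on every augmented frame over $\mathfrak{F}$. $\mathsf{QSIL}(\mathfrak{F}_D)$ is the set of $\mathcal{L}$-formulas valid on $\mathfrak{F}_D$. Logics: $\mathbf{QInt}$ is the set of $\mathcal{L}$-formulas valid on every (intuitionistic) Kripke frame. A superintuitionistic predicate logic is a set of $\mathcal{L}$-formulas including $\mathbf{QInt}$ and closed under Modus Ponens, Substitution (of formulas for predicate letters), and Generalization. $\mathbf{QLC}$ is the smallest superintuitionistic predicate logic containing $(p\to q)\vee(q\to p)$, with $p,q$ proposition letters; it is known to coincide with the set of formulas valid on all Kripke frames whose relation is a linear order. Hardness is with respect to computable many-one reductions. *)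

(* Defs.v *)
From Stdlib Require List.
From mathcomp Require Import all_boot.

Set Implicit Arguments.
Unset Strict Implicit.
Unset Printing Implicit Defensive.

(** * Predicate formulas *)

(* Individual variables are natural numbers.  [Atom k xs] is the atom built
   from the k-th predicate letter of arity [size xs]: a predicate letter is a
   pair (index, arity), and the arity is read off the argument list. *)
Inductive form : Type :=
| Atom of nat & seq nat
| Bot
| And of form & form
| Or of form & form
| Imp of form & form
| All of nat & form
| Ex of nat & form.

Fixpoint fv (phi : form) : seq nat :=
  match phi with
  | Atom _ xs => xs
  | Bot => [::]
  | And a b | Or a b | Imp a b => fv a ++ fv b
  | All x a | Ex x a => [seq y <- fv a | y != x]
  end.

(** * Substitution *)

Definition fresh (s : seq nat) : nat := (\max_(x <- s) x).+1.

Definition rename (x : nat) (s : seq nat) : nat :=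
  if x \in s then fresh s else x.

(* Capture-avoiding simultaneous renaming of the free variables along [r]. *)
Fixpoint vsubst (r : nat -> nat) (phi : form) : form :=
  match phi with
  | Atom k xs => Atom k (map r xs)
  | Bot => Bot
  | And a b => And (vsubst r a) (vsubst r b)
  | Or a b => Or (vsubst r a) (vsubst r b)
  | Imp a b => Imp (vsubst r a) (vsubst r b)
  | All x a =>
      let y := rename x (map r (fv (All x a))) in
      All y (vsubst [eta r with x |-> y] a)
  | Ex x a =>
      let y := rename x (map r (fv (Ex x a))) in
      Ex y (vsubst [eta r with x |-> y] a)
  end.

(* C[ys/xs]; [index z xs = size xs] when z is not in xs, so that a variable
   outside xs is left unchanged when xs and ys have the same length. *)
Definition instantiate (C : form) (xs ys : seq nat) : form :=
  vsubst (fun z => nth z ys (index z xs)) C.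

(* The free variables of [C] outside the list [xs] of formal arguments. *)
Definition params (C : form) (xs : seq nat) : seq nat :=
  [seq z <- fv C | z \notin xs].

(* Replaces every atom P(ys), P being the p-th letter of arity [size xs], by
   C[ys/xs].  The bound variables that would capture a parameter of C are
   renamed; [r] records the renamings performed so far. *)
Fixpoint psubst_ren (p : nat) (xs : seq nat) (C : form) (r : nat -> nat)
    (phi : form) : form :=
  match phi with
  | Atom k ys =>
      if (k == p) && (size ys == size xs) then instantiate C xs (map r ys)
      else Atom k (map r ys)
  | Bot => Bot
  | And a b => And (psubst_ren p xs C r a) (psubst_ren p xs C r b)
  | Or a b => Or (psubst_ren p xs C r a) (psubst_ren p xs C r b)
  | Imp a b => Imp (psubst_ren p xs C r a) (psubst_ren p xs C r b)
  | All x a =>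
      let y := rename x (map r (fv (All x a)) ++ params C xs) in
      All y (psubst_ren p xs C [eta r with x |-> y] a)
  | Ex x a =>
      let y := rename x (map r (fv (Ex x a)) ++ params C xs) in
      Ex y (psubst_ren p xs C [eta r with x |-> y] a)
  end.

Definition psubst (p : nat) (xs : seq nat) (C phi : form) : form :=
  psubst_ren p xs C id phi.

(** * Kripke semantics *)

Record kframe : Type := KFrame {
  world : Type;
  acc : world -> world -> Prop;
  world_inhabited : inhabited world;
  acc_refl : forall w, acc w w;
  acc_trans : forall u v w, acc u v -> acc v w -> acc u w;
  acc_anti : forall u v, acc u v -> acc v u -> u = v
}.

(* The sets D_w are subsets of a common type [carrier]. *)
Record aframe (F : kframe) : Type := AFrame {
  carrier : Type;
  dom : world F -> carrier -> Prop;
  dom_nonempty : forall w, exists a, dom w a;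
  dom_mono : forall u w, acc u w -> forall a, dom u a -> dom w a
}.

Arguments dom {F} _ _ _.

(* [interp w k s]: the tuple [s] is in the extension at [w] of the k-th
   letter of arity [size s]. *)
Record model (F : kframe) (A : aframe F) : Type := Model {
  interp : world F -> nat -> seq (carrier A) -> Prop;
  interp_dom : forall w k s, interp w k s -> List.Forall (dom A w) s;
  interp_mono : forall u w, acc u w ->
    forall k s, interp u k s -> interp w k s
}.

Fixpoint holds (F : kframe) (A : aframe F) (M : model A) (w : world F)
    (g : nat -> carrier A) (phi : form) : Prop :=
  match phi with
  | Atom k xs => interp M w k (map g xs)
  | Bot => False
  | And a b => holds M w g a /\ holds M w g b
  | Or a b => holds M w g a \/ holds M w g b
  | Imp a b => forall v, acc w v -> holds M v g a -> holds M v g b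
  | All x a => forall v, acc w v -> forall d, dom A v d ->
      holds M v [eta g with x |-> d] a
  | Ex x a => exists d, dom A w d /\ holds M w [eta g with x |-> d] a
  end.

(* [QSIL A] is the set of formulas valid on the augmented frame [A]. *)
Definition QSIL (F : kframe) (A : aframe F) (phi : form) : Prop :=
  forall (M : model A) (w : world F) (g : nat -> carrier A),
    (forall x, x \in fv phi -> dom A w (g x)) -> holds M w g phi.

Definition valid_on (F : kframe) (phi : form) : Prop :=
  forall A : aframe F, QSIL A phi.

Definition const_aframe (F : kframe) (U : Type) (u : inhabited U) : aframe F :=
  @AFrame F U (fun _ _ => True)
    (fun _ => match u with inhabits a => ex_intro _ a I end)
    (fun _ _ _ _ _ => I).

Lemma leq_antisymm (m n : nat) : m <= n -> n <= m -> m = n.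
Proof. by move=> mn nm; apply/eqP; rewrite eqn_leq mn nm. Qed.

Definition nat_frame : kframe :=
  @KFrame nat (fun m n => m <= n) (inhabits 0) leqnn
    (fun u v w uv vw => leq_trans uv vw) leq_antisymm.

Definition nat_frame_nat : aframe nat_frame := const_aframe nat_frame (inhabits 0).

(** * Superintuitionistic predicate logics *)

Definition QInt (phi : form) : Prop := forall F : kframe, valid_on F phi.

Record si_logic (L : form -> Prop) : Prop := SILogic {
  si_QInt : forall phi, QInt phi -> L phi;
  si_MP : forall phi psi, L phi -> L (Imp phi psi) -> L psi;
  si_subst : forall p xs C phi, uniq xs -> L phi -> L (psubst p xs C phi);
  si_gen : forall x phi, L phi -> L (All x phi)
}.

Definition linearity : form :=
  let p := Atom 0 [::] in let q := Atom 1 [::] in Or (Imp p q) (Imp q p).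

Definition QLC (phi : form) : Prop :=
  forall L : form -> Prop, si_logic L -> L linearity -> L phi.

(* Only the variables 0 and 1 occur, free or bound; the predicate letters are
   the binary letter of index 0 and arbitrary unary letters. *)
Fixpoint in_fragment (phi : form) : bool :=
  match phi with
  | Atom k xs => all (fun x => x < 2) xs &&
      ((size xs == 1) || ((size xs == 2) && (k == 0)))
  | Bot => true
  | And a b | Or a b | Imp a b => in_fragment a && in_fragment b
  | All x a | Ex x a => (x < 2) && in_fragment a
  end.

(** * Computability *)

(* Descriptions of partial recursive functions, applied to argument lists;
   arities are not enforced, and missing arguments of [RSucc] and [RProj] are
   read as 0. *)
Inductive recfun : Type :=
| RZero
| RSucc
| RProj of nat
| RComp of recfun & seq recfun
| RPrim of recfun & recfun
| RMin of recfun.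

Inductive eval : recfun -> seq nat -> nat -> Prop :=
| eval_zero v : eval RZero v 0
| eval_succ v : eval RSucc v (head 0 v).+1
| eval_proj i v : eval (RProj i) v (nth 0 v i)
| eval_comp f gs v ys z :
    evals gs v ys -> eval f ys z -> eval (RComp f gs) v z
| eval_prim0 f g v z : eval f v z -> eval (RPrim f g) (0 :: v) z
| eval_primS f g n v y z :
    eval (RPrim f g) (n :: v) y -> eval g [:: n, y & v] z ->
    eval (RPrim f g) (n.+1 :: v) z
| eval_min f v n (y : nat -> nat) :
    (forall m, m < n -> eval f (m :: v) (y m).+1) ->
    eval f (n :: v) 0 -> eval (RMin f) v n
with evals : seq recfun -> seq nat -> seq nat -> Prop :=
| evals_nil v : evals [::] v [::]
| evals_cons g gs v y ys :
    eval g v y -> evals gs v ys -> evals (g :: gs) v (y :: ys).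

Definition computable (f : nat -> nat) : Prop :=
  exists e, forall n, eval e [:: n] (f n).

Definition decidable_rel (r : nat -> nat -> bool) : Prop :=
  exists e, forall m n, eval e [:: m; n] (nat_of_bool (r m n)).

Definition Sigma01 (A : nat -> Prop) : Prop :=
  exists2 r : nat -> nat -> bool,
    decidable_rel r & forall n, A n <-> exists k, r n k.

Definition many_one_reducible (A B : nat -> Prop) : Prop :=
  exists2 f : nat -> nat, computable f & forall n, A n <-> B (f n).

Definition Sigma01_hard (B : nat -> Prop) : Prop :=
  forall A, Sigma01 A -> many_one_reducible A B.

(** * Goedel numbering *)

Definition cantor_pair (m n : nat) : nat := ((m + n) * (m + n).+1)./2 + n.

Fixpoint seq_code (s : seq nat) : nat :=
  if s is x :: s' then (cantor_pair x (seq_code s')).+1 else 0.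

Fixpoint code (phi : form) : nat :=
  match phi with
  | Atom k xs => cantor_pair 0 (cantor_pair k (seq_code xs))
  | Bot => cantor_pair 1 0
  | And a b => cantor_pair 2 (cantor_pair (code a) (code b))
  | Or a b => cantor_pair 3 (cantor_pair (code a) (code b))
  | Imp a b => cantor_pair 4 (cantor_pair (code a) (code b))
  | All x a => cantor_pair 5 (cantor_pair x (code a))
  | Ex x a => cantor_pair 6 (cantor_pair x (code a))
  end.

Lemma cantor_pair_inj m n m' n' :
  cantor_pair m n = cantor_pair m' n' -> m = m' /\ n = n'.
Proof.
rewrite /cantor_pair => E.
have tri s : (s.+1 * s.+2)./2 = (s * s.+1)./2 + s.+1.
  have -> : s.+1 * s.+2 = s * s.+1 + s.+1.*2.
    by rewrite -muln2 [s * _]mulnC -mulnDr addn2.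
  by rewrite halfD odd_double andbF doubleK.
have tri_mono s t : s <= t -> (s * s.+1)./2 <= (t * t.+1)./2.
  by move=> st; apply: half_leq; apply: leq_mul.
have aux a b c d : a + b < c + d ->
    ((a + b) * (a + b).+1)./2 + b < ((c + d) * (c + d).+1)./2 + d.
  move=> lt; apply: (@leq_trans (((a + b).+1 * (a + b).+2)./2)).
    by rewrite tri ltn_add2l ltnS leq_addl.
  exact: leq_trans (tri_mono _ _ lt) (leq_addr _ _).
have S : m + n = m' + n'.
  by case: (ltngtP (m + n) (m' + n')) => // /aux; rewrite E ltnn.
move: E; rewrite S => /addnI nn'; split=> //.
by move: S; rewrite nn' => /addIn.
Qed.

Lemma seq_code_inj : injective seq_code.
Proof.
elim=> [|x s IH] [|y t] //= [] /cantor_pair_inj [-> /IH ->] //.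
Qed.

Lemma code_inj : injective code.
Proof.
elim=> [k xs||a IHa b IHb|a IHa b IHb|a IHa b IHb|x a IHa|x a IHa]
       [k' xs'||a' b'|a' b'|a' b'|x' a'|x' a'] /= /cantor_pair_inj [] //.
- by move=> _ /cantor_pair_inj [-> /seq_code_inj ->].
- by move=> _ /cantor_pair_inj [/IHa -> /IHb ->].
- by move=> _ /cantor_pair_inj [/IHa -> /IHb ->].
- by move=> _ /cantor_pair_inj [/IHa -> /IHb ->].
- by move=> _ /cantor_pair_inj [-> /IHa ->].
- by move=> _ /cantor_pair_inj [-> /IHa ->].
Qed.

Definition codes (X : form -> Prop) (n : nat) : Prop :=
  exists2 phi, n = code phi & X phi.

(* Main.v *)
Require Import Defs.
From Stdlib Require Import Classical ClassicalEpsilon FunctionalExtensionality.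
From mathcomp Require Import all_boot.

(** Why the theorem holds.  A set in Sigma^0_1 has the form
    { n | exists k, r n k } with r decided by a description e.  For each n there
    is a formula of the fragment that is valid on all Kripke frames as soon as
    some k satisfies r n k, and that fails in a model on the constant-domain
    frame of the naturals when no k does.  Every logic in the interval then
    contains the formula exactly when n is in the set.

    Classical two-variable logic is decidable, so two variables have to borrow
    expressive power from the Kripke semantics.  The source is that an atom
    L(x) has more than two possible values: its truth set can be any up-set of
    worlds.  A unary letter is therefore a function from elements to values,
    and L(x) <-> L'(y) says that two such values agree.  On the frame of the
    naturals the values are thresholds: the number n is represented by the
    truth set of the worlds above n.  An element thus is a record with
    infinitely many number fields, and a formula with only two variables
    relates arbitrarily many fields of two records.

    A record stands for an argument list.  The letter [Arg j] gives its j-th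
    entry, [Scc] the successor of its first entry, [Out g] the value of the
    description g on the list.  The recursion equations of g become the formula
    [clauses g], of the shape: for every record there is another one, with
    prescribed arguments, whose output is linked to that of the first.
    Implications whose hypothesis is an equation need care: L(x) <-> L'(y) also
    becomes true at every world where both sides are true, whether or not their
    truth sets are the same.  The formula [Number 0], representing zero, repairs
    this.  Zero has the least threshold, so [Number 0] holds wherever any other
    value holds, and clauses with a hypothesis offer [Number 0] as an
    alternative conclusion.  The whole formula is
    (equations of the computation) -> [Number 0].

    If the search for k succeeds, then at a world that forces the equations but
    not [Number 0] an induction on the evaluation ([eval_numeral]) shows that
    the output fields have the right values; the clause [halt] then yields
    [Number 0] after all ([search_formula_QInt]).  If the search fails, the
    records of actual lists form a model in which all equations hold and
    [Number 0] fails at the world 0 ([search_formula_refuted]).  For this the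
    partial function of a description is completed to a total one, [den].
    Finally the code of the formula is a recursive function of n
    ([rec_form_search]), since n enters only through the numeral [Number n] and
    the chain of n formulas [links n] that gives it its value. *)

Set Implicit Arguments.
Unset Strict Implicit.
Unset Printing Implicit Defensive.

(** * Descriptions of recursive functions *)

Section RecfunInduction.

Variable P : recfun -> Prop.
Hypothesis P_zero : P RZero.
Hypothesis P_succ : P RSucc.
Hypothesis P_proj : forall i, P (RProj i).
Hypothesis P_comp :
  forall f gs, P f -> List.Forall P gs -> P (RComp f gs).
Hypothesis P_prim : forall f h, P f -> P h -> P (RPrim f h).
Hypothesis P_min : forall f, P f -> P (RMin f).

(** The automatically generated principle gives nothing for the list of inner
    functions of a composition. *)
Fixpoint recfun_nested_ind (g : recfun) : P g :=
  match g with
  | RZero => P_zero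
  | RSucc => P_succ
  | RProj i => P_proj i
  | RComp f gs =>
      P_comp (recfun_nested_ind f)
        ((fix all_P (s : seq recfun) : List.Forall P s :=
            match s with
            | [::] => List.Forall_nil P
            | g' :: s' =>
                List.Forall_cons g' (recfun_nested_ind g') (all_P s')
            end) gs)
  | RPrim f h => P_prim (recfun_nested_ind f) (recfun_nested_ind h)
  | RMin f => P_min (recfun_nested_ind f)
  end.

End RecfunInduction.

Scheme eval_evals_ind := Minimality for eval Sort Prop
  with evals_eval_ind := Minimality for evals Sort Prop.

Fixpoint rcode (g : recfun) : nat :=
  match g with
  | RZero => cantor_pair 0 0
  | RSucc => cantor_pair 1 0
  | RProj i => cantor_pair 2 i
  | RComp f gs =>
      cantor_pair 3 (cantor_pair (rcode f) (seq_code (map rcode gs)))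
  | RPrim f h => cantor_pair 4 (cantor_pair (rcode f) (rcode h))
  | RMin f => cantor_pair 5 (rcode f)
  end.

Lemma rcode_inj : injective rcode.
Proof.
elim/recfun_nested_ind => [||i|f gs IHf IHgs|f h IHf IHh|f IHf]
  [||i'|f' gs'|f' h'|f'] /cantor_pair_inj [] //.
- by move=> _ ->.
- move=> _ /cantor_pair_inj [/IHf -> /seq_code_inj E]; congr RComp.
  elim: IHgs gs' E => [|g s IHg _ IHs] [|g' s'] //= [/IHg -> E].
  by rewrite (IHs _ E).
- by move=> _ /cantor_pair_inj [/IHf -> /IHh ->].
- by move=> _ /IHf ->.
Qed.

(** The total value 0 when the search fails is compatible with the recursion
    equation [least_from_next]: a failing search also fails from the next
    number on. *)
Definition least_from (p : pred nat) (m : nat) : nat :=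
  match excluded_middle_informative (exists n, (m <= n) && p n) with
  | left ex => ex_minn ex
  | right _ => 0
  end.

Lemma least_from_unique (p : pred nat) m n :
  m <= n -> p n -> (forall i, m <= i < n -> ~~ p i) -> least_from p m = n.
Proof.
move=> mn pn below; rewrite /least_from.
case: excluded_middle_informative => [ex|[]]; last by exists n; rewrite mn.
case: ex_minnP => k /andP[mk pk] /(_ n); rewrite mn pn => /(_ isT) kn.
apply/eqP; rewrite eqn_leq kn leqNgt; apply/negP => lt_kn.
by move: (below k); rewrite mk lt_kn pk => /(_ isT).
Qed.

Lemma least_from_here (p : pred nat) m : p m -> least_from p m = m.
Proof.
move=> pm; apply: least_from_unique => // i /andP[mi im].
by rewrite ltnNge mi in im.
Qed.

Lemma least_from_next (p : pred nat) m :
  ~~ p m -> least_from p m.+1 = least_from p m.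
Proof.
move=> npm; rewrite {2}/least_from.
case: excluded_middle_informative => [ex|nex].
- case: ex_minnP => k /andP[mk pk] kmin.
  apply: least_from_unique => //.
    by rewrite ltn_neqAle mk andbT; apply: contraNneq npm => ->.
  move=> i /andP[mi ik]; apply/negP => pi.
  by move: (kmin i); rewrite (ltnW mi) pi leqNgt ik => /(_ isT).
- rewrite /least_from; case: excluded_middle_informative => // ex.
  by case: nex; case: ex => k /andP[mk pk]; exists k; rewrite (ltnW mk).
Qed.

(** A total function satisfying the recursion equations of [g] everywhere, also
    where the evaluation of [g] diverges; the model built below has an output
    field in every record. *)
Fixpoint den (g : recfun) (v : seq nat) : nat :=
  match g with
  | RZero => 0
  | RSucc => (head 0 v).+1
  | RProj i => nth 0 v i
  | RComp f gs => den f [seq den g' v | g' <- gs]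
  | RPrim f h =>
      nat_rect (fun _ => nat) (den f (behead v))
        (fun n y => den h [:: n, y & behead v]) (head 0 v)
  | RMin f => least_from (fun m => den f (m :: v) == 0) 0
  end.

(** Missing arguments count as zeros.  This makes it harmless that a record
    for the empty list has a first entry [Arg 0], of value zero. *)
Lemma den_rcons0 g v : den g (rcons v 0) = den g v.
Proof.
elim/recfun_nested_ind: g v => [||i|f gs _ IHgs|f h IHf IHh|f IHf] v //=.
- by case: v.
- by rewrite nth_rcons; case: ltngtP => // [lt|->]; rewrite nth_default // ltnW.
- by congr (den f _); elim: IHgs => //= g s -> _ ->.
- case: v => [|a v] //=; rewrite IHf.
  by elim: a => //= n ->; rewrite -(IHh [:: n, _ & v]).
- congr least_from; apply: functional_extensionality => m.
  by rewrite -(IHf (m :: v)).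
Qed.

Lemma den_head_behead g v : den g (head 0 v :: behead v) = den g v.
Proof. by case: v => //=; rewrite -(den_rcons0 g [::]). Qed.

Lemma eval_den g v z : eval g v z -> den g v = z.
Proof.
move: g v z; apply: (eval_evals_ind (P := fun g v z => den g v = z)
  (P0 := fun gs v ys => [seq den g' v | g' <- gs] = ys)) => //=.
- by move=> f gs v ys z _ -> _ ->.
- by move=> f h n v y z _ -> _ ->.
- move=> f v n y _ pos _ zero.
  apply: least_from_unique => //; first by rewrite zero.
  by move=> i /= lt_in; rewrite (pos _ lt_in).
- by move=> g gs v y ys _ -> _ ->.
Qed.

(** * The equations of a computation as formulas *)

(** The fields of a record.  [Const i] takes the same value i in all records;
    [Scc] is the successor of the first entry.  [Aux g] is the intermediate
    value of a loop: for a primitive recursion with first argument n, the value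
    at n+1; for a minimization with first argument m, the result of the search
    started at m instead of 0. *)
Inductive letter : Type :=
| Const of nat
| Arg of nat
| Scc
| Out of recfun
| Aux of recfun.

Definition lcode (l : letter) : nat :=
  match l with
  | Const i => cantor_pair 0 i
  | Arg j => cantor_pair 1 j
  | Scc => cantor_pair 2 0
  | Out g => cantor_pair 3 (rcode g)
  | Aux g => cantor_pair 4 (rcode g)
  end.

Arguments lcode : simpl never.

Lemma lcode_inj : injective lcode.
Proof.
move=> [i|j||g|g] [i'|j'||g'|g'] /cantor_pair_inj [] // _;
  by [move=> -> | move=> /rcode_inj ->].
Qed.

Definition At (l : letter) (x : nat) : form := Atom (lcode l) [:: x].
Definition Top : form := Imp Bot Bot.
Definition Iff (a b : form) : form := And (Imp a b) (Imp b a).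
Definition conj (s : seq form) : form := foldr And Top s.
Definition Number (i : nat) : form := Ex 0 (At (Const i) 0).

(** The record 1 has the first [m] entries [F 0], [F 1], ...; the terms [F j]
    speak of the record 0 from which it is called. *)
Definition args (m : nat) (F : nat -> form) : form :=
  conj [seq Iff (At (Arg j) 1) (F j) | j <- iota 0 m].

Arguments conj : simpl never.
Arguments args : simpl never.

Definition scons (T : Type) (a : T) (F : nat -> T) (j : nat) : T :=
  if j is j'.+1 then F j' else a.

Definition is_zero (l : letter) : form := Iff (At l 0) (Number 0).
(** Positivity is expressed without negation, as being a successor. *)
Definition is_succ (l : letter) : form := Ex 1 (Iff (At l 0) (At Scc 1)).
(** The alternative conclusion [Number 0] makes an equation in the hypothesis
    [a] mean what it should: it takes over at the worlds where an equivalence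
    holds only because both its sides have become true. *)
Definition guarded (a b : form) : form := All 0 (Imp a (Or (Number 0) b)).

(** Only that many leading arguments matter for [g].  A clause can prescribe
    finitely many entries of a record, and dropping the first entry of a list
    would otherwise leave its last one unknown. *)
Fixpoint reads (g : recfun) : nat :=
  match g with
  | RZero => 0
  | RSucc => 1
  | RProj i => i.+1
  | RComp f gs => foldr maxn 0 (map reads gs)
  | RPrim f h => (maxn (reads f) (reads h)).+1
  | RMin f => reads f
  end.

Definition comp_ax f gs : form :=
  All 0 (Ex 1 (And (args (reads f)
                     (nth (Number 0) [seq At (Out g) 0 | g <- gs]))
                   (Iff (At (Out (RComp f gs)) 0) (At (Out f) 1)))).

Definition prim_zero_ax f h : form :=
  guarded (is_zero (Arg 0))
    (Ex 1 (And (args (reads f) (fun j => At (Arg j.+1) 0))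
               (Iff (At (Out (RPrim f h)) 0) (At (Out f) 1)))).

Definition prim_aux_ax f h : form :=
  All 0 (Ex 1 (And (args (reads h)
                     (scons (At (Arg 0) 0)
                       (scons (At (Out (RPrim f h)) 0)
                         (fun j => At (Arg j.+1) 0))))
                   (Iff (At (Aux (RPrim f h)) 0) (At (Out h) 1)))).

(** The predecessor is the first entry of any record whose [Scc] is the given
    number; [succ_inj_ax] makes it unique. *)
Definition prim_succ_ax f h : form :=
  guarded (is_succ (Arg 0))
    (Ex 1 (And (Iff (At (Arg 0) 0) (At Scc 1))
          (And (conj [seq Iff (At (Arg j.+1) 1) (At (Arg j.+1) 0)
                     | j <- iota 0 (reads (RPrim f h)).-1])
               (Iff (At (Out (RPrim f h)) 0) (At (Aux (RPrim f h)) 1))))).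

Definition min_start_ax f : form :=
  All 0 (Ex 1 (And (args (reads f).+1
                     (scons (Number 0) (fun j => At (Arg j) 0)))
                   (Iff (At (Out (RMin f)) 0) (At (Aux (RMin f)) 1)))).

Definition min_found_ax f : form :=
  guarded (is_zero (Out f)) (Iff (At (Aux (RMin f)) 0) (At (Arg 0) 0)).

Definition min_next_ax f : form :=
  guarded (is_succ (Out f))
    (Ex 1 (And (args (reads f).+1 (scons (At Scc 0) (fun j => At (Arg j.+1) 0)))
               (Iff (At (Aux (RMin f)) 0) (At (Aux (RMin f)) 1)))).

Fixpoint clauses (g : recfun) : form :=
  match g with
  | RZero => All 0 (Iff (At (Out RZero) 0) (Number 0))
  | RSucc => All 0 (Iff (At (Out RSucc) 0) (At Scc 0))
  | RProj i => All 0 (Iff (At (Out (RProj i)) 0) (At (Arg i) 0))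
  | RComp f gs => And (comp_ax f gs) (And (clauses f) (conj (map clauses gs)))
  | RPrim f h =>
      And (And (prim_zero_ax f h) (And (prim_aux_ax f h) (prim_succ_ax f h)))
          (And (clauses f) (clauses h))
  | RMin f =>
      And (And (min_start_ax f) (And (min_found_ax f) (min_next_ax f)))
          (clauses f)
  end.

Definition succ_inj_ax : form :=
  All 0 (All 1 (Imp (Iff (At Scc 0) (At Scc 1))
    (Or (Number 0) (Iff (At (Arg 0) 0) (At (Arg 0) 1))))).

(** Candidates for the witness k are records [k; n], so that the field [Scc]
    of one record gives the first entry of the next. *)
Definition search_step_ax : form :=
  All 0 (Ex 1 (And (Iff (At (Arg 0) 1) (At Scc 0))
                   (Iff (At (Arg 1) 1) (At (Arg 1) 0)))).

Definition link (i : nat) : form :=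
  Ex 0 (And (Iff (At (Arg 0) 0) (Number i)) (Iff (At Scc 0) (Number i.+1))).

Fixpoint links (n : nat) : form :=
  if n is n'.+1 then And (link n') (links n') else Top.

Definition start (n : nat) : form :=
  Ex 0 (And (Iff (At (Arg 0) 0) (Number 0)) (Iff (At (Arg 1) 0) (Number n))).

Definition halt (e : recfun) (n : nat) : form :=
  All 0 (Imp (And (Iff (At (Arg 1) 0) (Number n)) (is_succ (Out e)))
             (Number 0)).

Definition theory (e : recfun) (n : nat) : form :=
  And (And (links n) (And (start n) (halt e n)))
      (And (And succ_inj_ax search_step_ax) (clauses e)).

Definition search_formula (e : recfun) (n : nat) : form :=
  Imp (theory e n) (Number 0).

Lemma in_fragment_conj s : all in_fragment s -> in_fragment (conj s).
Proof. by elim: s => //= a s IHs /andP[-> /IHs]. Qed.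

Lemma in_fragment_args m F :
  (forall j, in_fragment (F j)) -> in_fragment (args m F).
Proof.
by move=> fF; apply: in_fragment_conj; rewrite all_map; apply/allP => j _ /=;
  rewrite fF.
Qed.

Lemma in_fragment_and a b :
  in_fragment a -> in_fragment b -> in_fragment (And a b).
Proof. by move=> fa fb; apply/andP. Qed.

Lemma in_fragment_all a : in_fragment a -> in_fragment (All 0 a).
Proof. by []. Qed.

Lemma in_fragment_guarded a b :
  in_fragment a -> in_fragment b -> in_fragment (guarded a b).
Proof. by move=> fa fb; rewrite /= fa fb. Qed.

Lemma in_fragment_witness a b :
  in_fragment a -> in_fragment b -> in_fragment (Ex 1 (And a b)).
Proof. by move=> fa fb; rewrite /= fa fb. Qed.

Lemma in_fragment_clauses g : in_fragment (clauses g).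
Proof.
have rest m : in_fragment (conj [seq Iff (At (Arg j.+1) 1) (At (Arg j.+1) 0)
                                | j <- iota 0 m]).
  by apply: in_fragment_conj; rewrite all_map; apply/allP.
have head_args a E m : in_fragment a -> (forall j, in_fragment (E j)) ->
    in_fragment (args m (scons a E)).
  by move=> fa fE; apply: in_fragment_args => -[|j] /=.
elim/recfun_nested_ind: g => //.
- move=> f gs cf cgs; apply: in_fragment_and; last apply: in_fragment_and => //.
    apply: in_fragment_all; apply: in_fragment_witness => //.
    apply: in_fragment_args => j.
    by elim: gs j {cgs} => [|g gs IH] [|j] //=; rewrite IH.
  by apply: in_fragment_conj; elim: cgs => //= g s -> _.
- move=> f h cf ch; apply: in_fragment_and; last exact: in_fragment_and.
  apply: in_fragment_and; last apply: in_fragment_and.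
  + by apply: in_fragment_guarded => //; apply: in_fragment_witness => //;
      apply: in_fragment_args.
  + apply: in_fragment_all; apply: in_fragment_witness => //.
    by apply: (head_args) => // -[|j].
  + apply: in_fragment_guarded => //; apply: in_fragment_witness => //.
    exact: in_fragment_and.
- move=> f cf; apply: in_fragment_and => //.
  apply: in_fragment_and; last apply: in_fragment_and.
  + apply: in_fragment_all; apply: in_fragment_witness => //.
    exact: head_args.
  + exact: in_fragment_guarded.
  + by apply: in_fragment_guarded => //; apply: in_fragment_witness => //;
      apply: head_args.
Qed.

Lemma in_fragment_search e n : in_fragment (search_formula e n).
Proof.
rewrite /= in_fragment_clauses !andbT.
by elim: n => //= n ->.
Qed.

(** * Halting computations are provable *)

Section Derivation.

Variables (F : kframe) (A : aframe F) (M : model A).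
Variables (w : world F) (g0 : nat -> carrier A).

Definition ext (l : letter) (d : carrier A) (u : world F) : Prop :=
  interp M u (lcode l) [:: d].

Definition truth (g : nat -> carrier A) (a : form) (u : world F) : Prop :=
  holds M u g a.

Definition same (S T : world F -> Prop) : Prop :=
  (forall u, acc w u -> S u -> T u) /\ (forall u, acc w u -> T u -> S u).

Notation zero := (truth g0 (Number 0)).

(** The value [S] is forced to be the number [n] by a chain of successor
    records, all taken from the domain of the world [w]. *)
Fixpoint numeral (n : nat) (S : world F -> Prop) : Prop :=
  if n is n'.+1 then
    exists d, [/\ dom A w d, numeral n' (ext (Arg 0) d) & same S (ext Scc d)]
  else same S zero.

Definition lists (m : nat) (v : seq nat) (d : carrier A) : Prop :=
  forall j, j < m -> numeral (nth 0 v j) (ext (Arg j) d).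

Lemma same_sym S T : same S T -> same T S.
Proof. by case. Qed.

Lemma same_trans S T U : same S T -> same T U -> same S U.
Proof. by move=> [st ts] [tu ut]; split=> u wu; eauto. Qed.

Lemma numeral_same n S T : same S T -> numeral n T -> numeral n S.
Proof.
case: n => [|n] st /=; first exact: same_trans.
by move=> [d [dd nd Td]]; exists d; split=> //; apply: same_trans Td.
Qed.

Lemma numeral_succ n d :
  dom A w d -> numeral n (ext (Arg 0) d) -> numeral n.+1 (ext Scc d).
Proof. by exists d; split. Qed.

Lemma holds_conj (I : eqType) (a : I -> form) s g u :
  holds M u g (conj [seq a i | i <- s]) <->
  (forall i, i \in s -> holds M u g (a i)).
Proof.
elim: s => [|i s [IH1 IH2]]; first by split=> // _ v.
split=> [[ai /IH1 as_] k|ais].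
  by rewrite inE => /predU1P[->|/as_].
split; first by apply: ais; rewrite mem_head.
by apply: IH2 => k ks; apply: ais; rewrite inE ks orbT.
Qed.

Lemma lists_args m (E : nat -> form) v g :
  holds M w g (args m E) ->
  (forall j, j < m -> numeral (nth 0 v j) (truth g (E j))) ->
  lists m v (g 1).
Proof.
move=> /holds_conj argsE numE j jm.
apply: numeral_same (numE j jm); apply: argsE.
by rewrite mem_iota.
Qed.

Hypothesis zero_w : ~ zero w.

Lemma and_elim a b u g :
  holds M u g (And a b) -> holds M u g a /\ holds M u g b.
Proof. by []. Qed.

Lemma all_elim a g d :
  dom A w d -> holds M w g (All 0 a) -> holds M w [eta g with 0 |-> d] a.
Proof. by move=> dd /(_ w (acc_refl w) d dd). Qed.

Lemma witness_elim a b g :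
  holds M w g (Ex 1 (And a b)) ->
  exists2 d, dom A w d & holds M w [eta g with 1 |-> d] a /\
                         holds M w [eta g with 1 |-> d] b.
Proof. by move=> [d [dd ab]]; exists d. Qed.

(** At a world that does not force [Number 0], the alternative conclusion of a
    clause is void. *)
Lemma guarded_elim a b g d :
  dom A w d -> holds M w g (guarded a b) ->
  holds M w [eta g with 0 |-> d] a -> holds M w [eta g with 0 |-> d] b.
Proof.
move=> dd /(_ w (acc_refl w) d dd w (acc_refl w)) gab /gab.
by case.
Qed.

Hypothesis succ_inj : holds M w g0 succ_inj_ax.

Lemma numeral_pred n S d :
  dom A w d -> numeral n.+1 S -> same S (ext Scc d) ->
  numeral n (ext (Arg 0) d).
Proof.
move=> dd [c [dc nc Sc]] Sd; apply: numeral_same nc.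
have := succ_inj (acc_refl w) dd (acc_refl w) dc (acc_refl w).
case=> //.
exact: same_trans (same_sym Sd) Sc.
Qed.

Lemma lists_leq k m v d : k <= m -> lists m v d -> lists k v d.
Proof. by move=> km dv j jk; apply: dv; apply: leq_trans km. Qed.

Lemma numeral_is_succ n l d g :
  numeral n.+1 (ext l d) -> holds M w [eta g with 0 |-> d] (is_succ l).
Proof. by case=> c [dc _ ldc]; exists c; split. Qed.

Lemma prim_zero f h v z d :
  (forall c, dom A w c -> lists (reads f) v c -> numeral z (ext (Out f) c)) ->
  holds M w g0 (prim_zero_ax f h) -> dom A w d ->
  lists (reads (RPrim f h)) (0 :: v) d ->
  numeral z (ext (Out (RPrim f h)) d).
Proof.
move=> fz ax dd dv.
have [c dc [argc outc]] := witness_elim (guarded_elim dd ax (dv 0 isT)).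
apply: numeral_same outc _; apply: fz => //.
apply: (lists_args argc) => j jf.
by apply: (dv j.+1); rewrite /= ltnS leq_max jf.
Qed.

Lemma prim_succ f h n v y z d :
  (forall c, dom A w c -> lists (reads (RPrim f h)) (n :: v) c ->
     numeral y (ext (Out (RPrim f h)) c)) ->
  (forall c, dom A w c -> lists (reads h) [:: n, y & v] c ->
     numeral z (ext (Out h) c)) ->
  holds M w g0 (prim_aux_ax f h) -> holds M w g0 (prim_succ_ax f h) ->
  dom A w d -> lists (reads (RPrim f h)) (n.+1 :: v) d ->
  numeral z (ext (Out (RPrim f h)) d).
Proof.
move=> prev next aux ax dd dv.
have [c dc [argc [/holds_conj restc outc]]] :=
  witness_elim (guarded_elim dd ax (numeral_is_succ _ (dv 0 isT))).
have cv : lists (reads (RPrim f h)) (n :: v) c.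
  case=> [_|j jm]; first exact: numeral_pred (dv 0 isT) argc.
  apply: numeral_same (dv j.+1 jm); apply: restc.
  by rewrite mem_iota.
apply: numeral_same outc _.
have [b db [argb outb]] := witness_elim (all_elim dc aux).
apply: numeral_same outb _; apply: next => //.
apply: (lists_args argb) => -[_|[_|j jh]].
- exact: (cv 0).
- exact: prev.
- by apply: (cv j.+1); rewrite /= ltnS leq_max (ltn_trans _ jh) ?orbT.
Qed.

(** Induction on the distance from the current candidate to the least zero
    [n]. *)
Lemma min_search f v n y d :
  (forall m, m < n -> forall c, dom A w c -> lists (reads f).+1 (m :: v) c ->
     numeral (y m).+1 (ext (Out f) c)) ->
  (forall c, dom A w c -> lists (reads f).+1 (n :: v) c ->
     numeral 0 (ext (Out f) c)) ->
  holds M w g0 (min_found_ax f) -> holds M w g0 (min_next_ax f) ->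
  dom A w d -> lists (reads f).+1 (0 :: v) d ->
  numeral n (ext (Aux (RMin f)) d).
Proof.
move=> pos zero_n found next.
suff search k : k <= n -> forall c, dom A w c ->
    lists (reads f).+1 (n - k :: v) c ->
    numeral n (ext (Aux (RMin f)) c).
  by move=> dd dv; apply: (search n) => //; rewrite subnn.
elim: k => [_|k IH kn] c dc; rewrite ?subn0 => cv.
  have out0 := zero_n c dc cv.
  exact: numeral_same (guarded_elim dc found out0) (cv 0 isT).
have lt_n : n - k.+1 < n by rewrite ltn_subrL (leq_trans _ kn).
have E : (n - k.+1).+1 = n - k by rewrite subnSK.
have [b db [argb outb]] :=
  witness_elim (guarded_elim dc next (numeral_is_succ _ (pos _ lt_n c dc cv))).
have b0 : numeral (n - k) (ext Scc c) 
  by rewrite -E; apply: numeral_succ => //; apply: (cv 0).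
apply: numeral_same outb _; apply: (IH (ltnW kn)) => //.
apply: (lists_args argb) => -[_|j jf] //.
exact: (cv j.+1).
Qed.


(** The computation is carried out inside the domain of a single world: each
    evaluation step is matched by one clause.  The motive for a list of
    functions is phrased through the terms that [comp_ax] passes on; past the
    end of the list both sides are zero. *)
Lemma eval_numeral g v z :
  eval g v z -> holds M w g0 (clauses g) ->
  forall d, dom A w d -> lists (reads g) v d -> numeral z (ext (Out g) d).
Proof.
move: g v z.
apply: (eval_evals_ind
  (P := fun g v z => holds M w g0 (clauses g) ->
     forall d, dom A w d -> lists (reads g) v d -> numeral z (ext (Out g) d))
  (P0 := fun gs v ys => holds M w g0 (conj (map clauses gs)) ->
     forall d, dom A w d -> lists (foldr maxn 0 (map reads gs)) v d ->
     forall j g, numeral (nth 0 ys j)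
       (truth [eta [eta g0 with 0 |-> d] with 1 |-> g]
          (nth (Number 0) [seq At (Out g) 0 | g <- gs] j)))).
- by move=> v ax d dd _; apply: all_elim dd ax.
- move=> v ax d dd dv; apply: numeral_same (all_elim dd ax) _.
  by apply: numeral_succ => //; rewrite -nth0; apply: dv.
- move=> i v ax d dd dv; apply: numeral_same (all_elim dd ax) _.
  exact: dv.
- move=> f gs v ys z _ IHgs _ IHf /and_elim[ax /and_elim[axf axgs]] d dd dv.
  have [c dc [argc outc]] := witness_elim (all_elim dd ax).
  apply: numeral_same outc _; apply: IHf => //.
  by apply: (lists_args argc) => j _; apply: IHgs.
- move=> f h v z _ IHf /and_elim[/and_elim[ax _] /and_elim[axf _]] d dd.
  by apply: prim_zero => //; apply: IHf.
- move=> f h n v y z _ IHp _ IHh ax d dd.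
  have [/and_elim[_ /and_elim[aux step]] /and_elim[_ axh]] := and_elim ax.
  by apply: (@prim_succ f h n v y) => //; [apply: IHp | apply: IHh].
- move=> f v n y _ pos _ zero_n.
  move=> /and_elim[/and_elim[init /and_elim[found next]] axf] d dd dv.
  have [c dc [argc outc]] := witness_elim (all_elim dd init).
  apply: numeral_same outc _.
  apply: (@min_search f v n y) => //.
  + by move=> m mn b db bv; apply: pos => //; apply: lists_leq bv.
  + by move=> b db bv; apply: zero_n => //; apply: lists_leq bv.
  + apply: (lists_args argc) => -[_|j jm]; first by split.
    exact: (dv j).
- by move=> v _ d _ _ [|j].
- move=> g gs v y ys _ IHg _ IHgs /and_elim[axg axgs] d dd dv.
  have dg : lists (reads g) v d by apply: lists_leq dv; rewrite /= leq_maxl.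
  have dgs : lists (foldr maxn 0 (map reads gs)) v d.
    by apply: lists_leq dv; rewrite /= leq_maxr.
  by case=> [|j] c; [apply: IHg | apply: IHgs].
Qed.

Lemma links_numeral n :
  holds M w g0 (links n) -> numeral n (truth g0 (Number n)).
Proof.
elim: n => [_|n IH [[d [dd [argd succd]]] /IH numn]]; first by split.
apply: numeral_same (same_sym succd) _; apply: numeral_succ => //.
exact: numeral_same argd numn.
Qed.

Lemma search_reaches n k :
  holds M w g0 (start n) -> holds M w g0 search_step_ax ->
  exists2 d, dom A w d &
    numeral k (ext (Arg 0) d) /\ same (ext (Arg 1) d) (truth g0 (Number n)).
Proof.
move=> [d [dd [d0 d1]]] step; elim: k => [|k [c dc [ck cn]]]; first by exists d.
have [b db [b0 b1]] := witness_elim (all_elim dc step).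
exists b => //; split; last exact: same_trans b1 cn.
by apply: numeral_same b0 _; apply: numeral_succ.
Qed.

End Derivation.

(** The candidates are the records [k; n] whose second entry is exactly
    [Number n]; other entries are unknown, hence the bound on [reads e]. *)
Lemma search_formula_QInt e n k y :
  reads e <= 2 -> eval e [:: k; n] y.+1 -> QInt (search_formula e n).
Proof.
move=> e2 ev F A M w0 g _ w _ [[lks [st hlt]] [[inj step] ax]].
apply: NNPP => zero_w.
have [d dd [dk dn]] := search_reaches k st step.
apply: (zero_w); apply: (hlt w (acc_refl w) d dd w (acc_refl w)); split=> //.
apply: (@numeral_is_succ _ _ _ _ g y).
apply: (eval_numeral zero_w inj ev ax dd).
apply: lists_leq e2 _ => -[|[|j]] // _.
exact: numeral_same dn (links_numeral lks).
Qed.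

(** * Other computations are refutable *)

(** On the empty list the first entry reads as 0, so both loops take their
    first argument with [head] and the others with [behead]. *)
Definition val (l : letter) (v : seq nat) : nat :=
  match l with
  | Const i => i
  | Arg j => nth 0 v j
  | Scc => (head 0 v).+1
  | Out g => den g v
  | Aux (RPrim f h) => den h [:: head 0 v, den (RPrim f h) v & behead v]
  | Aux (RMin f) => least_from (fun m => den f (m :: behead v) == 0) (head 0 v)
  | Aux _ => 0
  end.

(** The strict inequality keeps all atoms false at the world 0. *)
Definition threshold_interp (w : nat) (k : nat) (s : seq nat) : Prop :=
  exists l d, [/\ k = lcode l, s = [:: d] & val l (CodeSeq.decode d) < w].

Lemma threshold_interp_mono u w :
  u <= w -> forall k s, threshold_interp u k s -> threshold_interp w k s.
Proof.
move=> uw k s [l [d [-> -> lt]]]; exists l, d.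
by split=> //; apply: leq_trans uw.
Qed.

Lemma all_dom w (s : seq nat) : List.Forall (dom nat_frame_nat w) s.
Proof. by elim: s => [|a s IHs]; constructor. Qed.

Definition threshold_model : model nat_frame_nat :=
  @Model nat_frame nat_frame_nat threshold_interp
    (fun w k s _ => all_dom w s) threshold_interp_mono.

Definition has_value (g : nat -> nat) (a : form) (n : nat) : Prop :=
  forall u, @holds nat_frame nat_frame_nat threshold_model u g a <-> n < u.

Notation mholds := (@holds nat_frame nat_frame_nat threshold_model).

Lemma At_value g l x : has_value g (At l x) (val l (CodeSeq.decode (g x))).
Proof.
move=> u; split=> [[l' [d [/lcode_inj -> [->]]]] //|lt].
by exists l, (g x).
Qed.

Lemma Number_value g i : has_value g (Number i) i.
Proof.
move=> u; split=> [[d [_ /At_value]]|iu] //.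
by exists 0; split=> //; apply/At_value.
Qed.

Lemma Iff_same_value g a b n u :
  has_value g a n -> has_value g b n -> mholds u g (Iff a b).
Proof. by move=> an bn; split=> v _; [move=> /an/bn | move=> /bn/an]. Qed.

(** At the world 0 no value has been reached yet, so an equivalence there is a
    true equation of numbers. *)
Lemma Iff_value g a b m n :
  has_value g a m -> has_value g b n -> mholds 0 g (Iff a b) -> m = n.
Proof.
move=> am bn [ab ba].
have nm : n <= m by rewrite -ltnS; apply/bn/ab => //; apply/am.
have mn : m <= n by rewrite -ltnS; apply/am/ba => //; apply/bn.
by apply/eqP; rewrite eqn_leq mn nm.
Qed.

Lemma refutes_zero g : ~ mholds 0 g (Number 0).
Proof. by move/Number_value. Qed.

(** Every later world forces [Number 0], so only the world 0 has to be
    checked. *)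
Lemma guarded_intro w g a b :
  (forall d, mholds 0 [eta g with 0 |-> d] a ->
             mholds 0 [eta g with 0 |-> d] b) ->
  mholds w g (guarded a b).
Proof.
move=> ab v _ d _ [|u] _ ha; first by right; apply: ab.
by left; apply/Number_value.
Qed.

Lemma witness_intro v u g a b :
  (forall h, h 0 = g 0 -> CodeSeq.decode (h 1) = v -> mholds u h a) ->
  (forall h, h 0 = g 0 -> CodeSeq.decode (h 1) = v -> mholds u h b) ->
  mholds u g (Ex 1 (And a b)).
Proof.
move=> ha hb; exists (CodeSeq.code v); split=> //.
by split; [apply: ha | apply: hb]; rewrite //= CodeSeq.codeK.
Qed.

Lemma args_intro u g m F v :
  CodeSeq.decode (g 1) = v -> (forall j, has_value g (F j) (nth 0 v j)) ->
  mholds u g (args m F).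
Proof.
move=> gv Fv; apply/holds_conj => j _.
by apply: Iff_same_value (Fv j); rewrite -gv; apply: At_value.
Qed.

Lemma At_value_eq g l x n :
  val l (CodeSeq.decode (g x)) = n -> has_value g (At l x) n.
Proof. by move=> <-; apply: At_value. Qed.

Lemma Iff_At u g l x l' y :
  val l (CodeSeq.decode (g x)) = val l' (CodeSeq.decode (g y)) ->
  mholds u g (Iff (At l x) (At l' y)).
Proof. by move=> E; apply: Iff_same_value (At_value_eq E) (At_value _ _ _). Qed.

Lemma is_succ_value g l d :
  mholds 0 [eta g with 0 |-> d] (is_succ l) -> 0 < val l (CodeSeq.decode d).
Proof.
by move=> [c [_ /(Iff_value (At_value _ _ _) (At_value _ _ _)) /= ->]].
Qed.

Lemma is_zero_value g l d :
  mholds 0 [eta g with 0 |-> d] (is_zero l) -> val l (CodeSeq.decode d) = 0.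
Proof. exact: Iff_value (At_value _ _ _) (Number_value _ _). Qed.

Lemma clauses_hold u g k : mholds u g (clauses k).
Proof.
elim/recfun_nested_ind: k => [||i|f gs IHf IHgs|f h IHf IHh|f IHf].
- by move=> w _ d _; apply: Iff_same_value (At_value _ _ _) (Number_value _ _).
- by move=> w _ d _; apply: Iff_At.
- by move=> w _ d _; apply: Iff_At.
- split; last first.
    split=> //; elim: IHgs => [|k s IHk _ IHs]; first by move=> v _.
    by split.
  move=> w _ d _; pose v := CodeSeq.decode d.
  apply: (@witness_intro [seq den k v | k <- gs]) => b b0 b1.
    apply: args_intro b1 _ => j.
    elim: gs j {IHgs} => [|k gs IH] j.
      by rewrite !nth_nil; apply: Number_value.
    by case: j => [|j]; [apply: At_value_eq; rewrite b0 | apply: IH].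
  by apply: Iff_At; rewrite b0 b1.
- split; last by split.
  split; last split.
  + apply: guarded_intro => d /is_zero_value d0.
    apply: (@witness_intro (behead (CodeSeq.decode d))) => b b0 b1.
      apply: args_intro b1 _ => j.
      by apply: At_value_eq; rewrite b0 nth_behead.
    by apply: Iff_At; rewrite b0 b1 /= -nth0 [nth _ _ _]d0.
  + move=> w _ d _; pose v := CodeSeq.decode d.
    apply: (@witness_intro [:: head 0 v, den (RPrim f h) v & behead v])
      => b b0 b1.
      apply: args_intro b1 _ => -[|[|j]] /=; apply: At_value_eq; rewrite b0 //=.
      by rewrite nth_behead.
    by apply: Iff_At; rewrite b0 b1.
  + apply: guarded_intro => d /is_succ_value.
    case E: (CodeSeq.decode d) => [|[|n] v] // _.
    apply: (@witness_intro (n :: v)) => b b0 b1.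
      by apply: Iff_At; rewrite b0 b1 /= E.
    split; last by apply: Iff_At; rewrite b0 b1 /= E.
    by apply/holds_conj => j _; apply: Iff_At; rewrite b0 b1 /= E.
- split=> //; split; last split.
  + move=> w _ d _; apply: (@witness_intro (0 :: CodeSeq.decode d)) => b b0 b1.
      apply: args_intro b1 _ => -[|j] /=; first exact: Number_value.
      by apply: At_value_eq; rewrite b0.
    by apply: Iff_At; rewrite b0 b1.
  + apply: guarded_intro => d /is_zero_value d0.
    apply: Iff_At; rewrite /= nth0; apply: least_from_here.
    by rewrite den_head_behead [den _ _]d0.
  + apply: guarded_intro => d /is_succ_value d0.
    pose v := CodeSeq.decode d.
    apply: (@witness_intro ((head 0 v).+1 :: behead v)) => b b0 b1.
      apply: args_intro b1 _ => -[|j]; apply: At_value_eq; rewrite b0 //=.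
      by rewrite nth_behead.
    apply: Iff_At; rewrite b0 b1 /=; apply/esym/least_from_next.
    by rewrite den_head_behead -lt0n; apply: d0.
Qed.

Lemma links_hold u g n : mholds u g (links n).
Proof.
elim: n => [|n IH]; first by move=> v _.
split=> //; exists (CodeSeq.code [:: n]); split=> //.
by split; apply: Iff_same_value (At_value _ _ _) _; rewrite CodeSeq.codeK;
  apply: Number_value.
Qed.

Lemma start_holds u g n : mholds u g (start n).
Proof.
exists (CodeSeq.code [:: 0; n]); split=> //.
by split; apply: Iff_same_value (At_value _ _ _) _; rewrite CodeSeq.codeK;
  apply: Number_value.
Qed.

Lemma succ_inj_holds u g : mholds u g succ_inj_ax.
Proof.
move=> u1 _ d _ u2 _ c _ [|u3] _; last by left; apply/Number_value.
move=> /(Iff_value (At_value _ _ _) (At_value _ _ _)) E.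
by right; apply: Iff_At; case: E => E; rewrite /= !nth0.
Qed.

Lemma search_step_holds u g : mholds u g search_step_ax.
Proof.
move=> w _ d _; pose v := CodeSeq.decode d.
by apply: (@witness_intro [:: (head 0 v).+1; nth 0 v 1]) => b b0 b1;
  apply: Iff_At; rewrite b0 b1.
Qed.

(** The one axiom that a successful search would violate. *)
Lemma halt_holds u g e n :
  (forall v, nth 0 v 1 = n -> den e v = 0) -> mholds u g (halt e n).
Proof.
move=> e0 w _ d _ [|t] _; last by move=> _; apply/Number_value.
move=> [/(Iff_value (At_value _ _ _) (Number_value _ _)) dn /is_succ_value].
by rewrite /= e0.
Qed.

Lemma search_formula_refuted e n :
  (forall v, nth 0 v 1 = n -> den e v = 0) ->
  ~ QSIL nat_frame_nat (search_formula e n).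
Proof.
move=> e0 /(_ threshold_model 0 id) qs.
apply: (@refutes_zero id); apply: (qs _ 0 (leqnn 0)) => //.
split; last by split; [split; [apply: succ_inj_holds | apply: search_step_holds]
                      | apply: clauses_hold].
split; first exact: links_hold.
by split; [apply: start_holds | apply: halt_holds].
Qed.

(** * The formula is computable from the input *)

Definition recursive (f : seq nat -> nat) : Prop :=
  exists e, forall v, eval e v (f v).

Lemma recursive_comp f gs :
  recursive f -> List.Forall recursive gs ->
  recursive (fun v => f [seq g v | g <- gs]).
Proof.
move=> [e ev] rgs.
suff [es ess] : exists es, forall v, evals es v [seq g v | g <- gs].
  by exists (RComp e es) => v; apply: eval_comp (ess v) (ev _).
elim: rgs => [|g s [k kv] _ [es ess]]; first by exists [::] => v; constructor.
by exists (k :: es) => v; constructor.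
Qed.

Lemma recursive_proj i : recursive (fun v => nth 0 v i).
Proof. by exists (RProj i) => v; constructor. Qed.

Lemma recursive_succ f : recursive f -> recursive (fun v => (f v).+1).
Proof.
move=> rf; apply: (@recursive_comp (fun v => (head 0 v).+1) [:: f]).
  by exists RSucc => v; constructor.
by constructor.
Qed.

Lemma recursive_const c : recursive (fun _ => c).
Proof.
elim: c => [|c]; last exact: recursive_succ.
by exists RZero => v; constructor.
Qed.

Lemma recursive_prim (b : nat -> nat) (h : nat -> nat -> nat -> nat)
    (f : nat -> nat -> nat) :
  recursive (fun v => b (nth 0 v 0)) ->
  recursive (fun v => h (nth 0 v 0) (nth 0 v 1) (nth 0 v 2)) ->
  (forall a, f 0 a = b a) -> (forall n a, f n.+1 a = h n (f n a) a) ->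
  forall m a, recursive m -> recursive a -> recursive (fun v => f (m v) (a v)).
Proof.
move=> [eb evb] [eh evh] f0 fS m a rm ra.
suff rf : forall n c, eval (RPrim eb eh) [:: n; c] (f n c).
  case: rm ra => [em evm] [ea eva].
  exists (RComp (RPrim eb eh) [:: em; ea]) => v.
  by apply: eval_comp (rf _ _); do !constructor.
elim=> [|n IH] c; first by rewrite f0; constructor; apply: (evb [:: c]).
by rewrite fS; apply: eval_primS (IH c) _; apply: (evh [:: n; f n c; c]).
Qed.

Lemma recursive_add f g :
  recursive f -> recursive g -> recursive (fun v => f v + g v).
Proof.
move: f g; apply: (recursive_prim (b := id) (h := fun _ y _ => y.+1)) => //.
- exact: recursive_proj.
- exact/recursive_succ/recursive_proj.
Qed.

Lemma triangle_succ s : (s.+1 * s.+2)./2 = (s * s.+1)./2 + s.+1.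
Proof.
have -> : s.+1 * s.+2 = s * s.+1 + s.+1.*2.
  by rewrite -muln2 [s * _]mulnC -mulnDr addn2.
by rewrite halfD odd_double andbF doubleK.
Qed.

(** Triangular numbers are obtained by adding up, which avoids the halving in
    their closed form. *)
Lemma recursive_triangle f :
  recursive f -> recursive (fun v => (f v * (f v).+1)./2).
Proof.
move=> rf.
apply: (recursive_prim (b := fun _ => 0) (h := fun n y _ => y + n.+1)
         (f := fun n _ => (n * n.+1)./2) _ _ _ _ rf (recursive_const 0)) => //.
- exact: recursive_const.
- apply: recursive_add; first exact: recursive_proj.
  exact/recursive_succ/recursive_proj.
- by move=> n _; apply: triangle_succ.
Qed.

Lemma recursive_pair f g :
  recursive f -> recursive g -> recursive (fun v => cantor_pair (f v) (g v)).
Proof.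
move=> rf rg; apply: recursive_add => //.
by apply: recursive_triangle; apply: recursive_add.
Qed.

(** The index of the family is read off the first argument. *)
Definition rec_form (a : nat -> form) : Prop :=
  recursive (fun v => code (a (nth 0 v 0))).

Lemma rec_form_const a : rec_form (fun _ => a).
Proof. exact: recursive_const. Qed.

Lemma rec_form_And a b :
  rec_form a -> rec_form b -> rec_form (fun n => And (a n) (b n)).
Proof.
by move=> ra rb; do ![apply: recursive_pair => //]; apply: recursive_const.
Qed.

Lemma rec_form_Imp a b :
  rec_form a -> rec_form b -> rec_form (fun n => Imp (a n) (b n)).
Proof.
by move=> ra rb; do ![apply: recursive_pair => //]; apply: recursive_const.
Qed.

Lemma rec_form_All x a : rec_form a -> rec_form (fun n => All x (a n)).
Proof.
by move=> ra; do ![apply: recursive_pair => //]; apply: recursive_const.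
Qed.

Lemma rec_form_Ex x a : rec_form a -> rec_form (fun n => Ex x (a n)).
Proof.
by move=> ra; do ![apply: recursive_pair => //]; apply: recursive_const.
Qed.

Lemma rec_form_Iff a b :
  rec_form a -> rec_form b -> rec_form (fun n => Iff (a n) (b n)).
Proof. by move=> ra rb; apply: rec_form_And; apply: rec_form_Imp. Qed.

Lemma rec_form_Number (f : nat -> nat) :
  recursive (fun v => f (nth 0 v 0)) -> rec_form (fun n => Number (f n)).
Proof.
move=> rf; apply: rec_form_Ex.
by do ![apply: recursive_pair => //]; apply: recursive_const.
Qed.

Lemma rec_form_links : rec_form links.
Proof.
have rec_link : rec_form link.
  apply: rec_form_Ex; apply: rec_form_And; apply: rec_form_Iff;
    try exact: rec_form_const; apply: rec_form_Number.
    exact: recursive_proj.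
  exact/recursive_succ/recursive_proj.
apply: (recursive_prim (b := fun _ => code Top)
  (h := fun n y _ => cantor_pair 2 (cantor_pair (code (link n)) y))
  (f := fun n _ => code (links n)) _ _ _ _
  (recursive_proj 0) (recursive_const 0)) => //.
- exact: recursive_const.
- apply: recursive_pair; first exact: recursive_const.
  by apply: recursive_pair; last exact: recursive_proj.
Qed.

Lemma rec_form_search e : rec_form (search_formula e).
Proof.
apply: rec_form_Imp; last exact: rec_form_const.
apply: rec_form_And; last exact: rec_form_const.
apply: rec_form_And; first exact: rec_form_links.
have rV := rec_form_Number (f := id) (recursive_proj 0).
apply: rec_form_And.
  apply: rec_form_Ex; apply: rec_form_And; first exact: rec_form_const.
  by apply: rec_form_Iff => //; apply: rec_form_const.
apply: rec_form_All; apply: rec_form_Imp; last exact: rec_form_const.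
apply: rec_form_And; last exact: rec_form_const.
by apply: rec_form_Iff => //; apply: rec_form_const.
Qed.

Theorem theorem6p2 (L : form -> Prop) (L_si : si_logic L)
    (QLC_L : forall phi : form, QLC phi -> L phi)
    (L_QSIL : forall phi : form, L phi -> QSIL nat_frame_nat phi) :
  Sigma01_hard (codes (fun phi => L phi /\ in_fragment phi)).
Proof.
move=> A [r [e evr] Ar].
(* The description with its two arguments exchanged: the search variable comes
   first, in front of the input. *)
pose e' := RComp e [:: RProj 1; RProj 0].
have ev n k : eval e' [:: k; n] (r n k).
  by apply: eval_comp (evr n k); do !constructor.
exists (fun n => code (search_formula e' n)).
  have [p pv] := rec_form_search e'.
  by exists p => n; apply: (pv [:: n]).
move=> n; split=> [/Ar [k rnk]|[phi /code_inj <- [Lphi _]]].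
  exists (search_formula e' n) => //; split; last exact: in_fragment_search.
  apply: si_QInt L_si _ _.
  apply: (@search_formula_QInt _ _ k 0) => //.
  by have := ev n k; rewrite rnk.
apply/Ar; apply: NNPP => none.
apply: (@search_formula_refuted e' n) (L_QSIL _ Lphi) => v vn.
rewrite /= vn (eval_den (evr _ _)).
by case rnk: (r _ _) => //; case: none; exists (nth 0 v 0).
Qed.
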